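(* Let $X$ be a quasiregular space with an H-closed $\pi$-base. Then $X$ is Baire.
   Context: All spaces are Hausdorff topological spaces. A space $X$ is quasiregular if for every non-empty open set $U\subseteq X$ there is a non-empty open set $V\subseteq X$ with $\overline{V}\subseteq U$. A space $Y$ is H-closed if it is Hausdorff and closed in every Hausdorff space in which it is embedded; equivalently, $Y$ is Hausdorff and every open cover $\mathcal{U}$ of $Y$ has a finite subfamily $\mathcal{V}\subseteq\mathcal{U}$ with $\overline{\bigcup\mathcal{V}}=Y$. A $\pi$-base of $X$ is a family $\mathcal{B}$ of non-empty open subsets of $X$ such that every non-empty open subset of $X$ contains a member of $\mathcal{B}$. An H-closed $\pi$-base is a $\pi$-base $\mathcal{B}$ such that $\overline{B}$, as a subspace, is H-closed for every $B\in\mathcal{B}$. A space is Baire if every countable intersection of open dense subsets is dense. *)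

(* Defs.v *)
From mathcomp Require Import all_boot all_classical.
From mathcomp Require Import all_analysis.

Set Implicit Arguments.
Unset Strict Implicit.
Unset Printing Implicit Defensive.

Local Open Scope classical_set_scope.

Definition quasiregular (X : topologicalType) : Prop :=
  forall U : set X, open U -> U !=set0 ->
    exists V : set X, [/\ open V, V !=set0 & closure V `<=` U].

(* Injectivity together with: the topology of [Y] is the one induced by [f],
   i.e. [f] is a homeomorphism onto its image. *)
Definition embedding (Y Z : topologicalType) (f : Y -> Z) : Prop :=
  injective f /\
  forall U : set Y, open U <-> exists2 V : set Z, open V & f @^-1` V = U.

Definition h_closed (Y : topologicalType) : Prop :=
  hausdorff_space Y /\
  forall (Z : topologicalType) (f : Y -> Z),
    hausdorff_space Z -> embedding f -> closed (range f).

Definition pi_base (X : topologicalType) (B : set (set X)) : Prop :=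
  (forall A : set X, B A -> open A /\ A !=set0) /\
  forall U : set X, open U -> U !=set0 -> exists2 A : set X, B A & A `<=` U.

(* The subspace is the type [set_type (closure A)] with the topology induced by
   its inclusion in [X]. The library's [subspace (closure A)] would be wrong
   here: its carrier is all of [X], with the points outside the set isolated. *)
Definition h_closed_pi_base (X : topologicalType) (B : set (set X)) : Prop :=
  pi_base B /\ forall A : set X, B A -> h_closed (set_type (closure A)).

Definition baire_space (X : topologicalType) : Prop :=
  forall F : set (set X), countable F ->
    (forall U : set X, F U -> open U /\ dense U) ->
    dense (\bigcap_(U in F) U).

(* Main.v *)
Require Import Defs.
From mathcomp Require Import all_boot all_classical.
From mathcomp Require Import all_analysis.
From HB Require Import structures.

(** An H-closed space, defined by being closed in every Hausdorff extension,
    has the filter property of compact spaces restricted to open filters: if a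
    proper filter with a base of open sets had no cluster point, adjoining one
    point whose neighbourhoods are the members of the filter would give a
    Hausdorff extension in which the original space is dense but not closed
    ([h_closed_cluster]).  So the closures of a decreasing sequence of
    non-empty open sets inside an H-closed closure have a common point
    ([nested_open_closures_meet]).

    With this the usual proof of the Baire theorem goes through.  In a
    non-empty open [O], quasiregularity and the pi-base give a non-empty open
    [A] with H-closed closure contained in [O].  Starting from [A],
    quasiregularity gives non-empty open sets [V n] with
    [closure (V n.+1) `<=` V n `&` D n], where [D] enumerates the dense open
    sets.  A point common to the closures of the [V n] lies in [O] and in every
    [D n]. *)

Set Implicit Arguments.
Unset Strict Implicit.
Unset Printing Implicit Defensive.

Local Open Scope classical_set_scope.

(** The space [Y] with a limit adjoined to the filter [F]; the parameter [F]
    lets the type determine the topology. *)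
Definition adjoin_limit (Y : topologicalType) (F : filter_on Y) := option Y.

HB.instance Definition _ (Y : topologicalType) (F : filter_on Y) :=
  Choice.on (adjoin_limit F).

Definition adjoin_limit_open (Y : topologicalType) (F : filter_on Y) :
    set_system (adjoin_limit F) :=
  [set W | open (Some @^-1` W : set Y) /\ (W None -> (F : set_system Y) (Some @^-1` W))].

Lemma adjoin_limit_openT (Y : topologicalType) (F : filter_on Y) :
  @adjoin_limit_open Y F setT.
Proof. by split=> [|_]; rewrite preimage_setT; [exact: openT|exact: filterT]. Qed.

Lemma adjoin_limit_openI (Y : topologicalType) (F : filter_on Y) :
  setI_closed (@adjoin_limit_open Y F).
Proof.
move=> A B [oA FA] [oB FB]; rewrite /adjoin_limit_open /= preimage_setI.
by split=> [|[An Bn]]; [exact: openI|apply: filterI; [exact: FA|exact: FB]].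
Qed.

Lemma adjoin_limit_open_bigU (Y : topologicalType) (F : filter_on Y)
    (I : Type) (f : I -> set (adjoin_limit F)) :
  (forall i, adjoin_limit_open (f i)) -> adjoin_limit_open (\bigcup_i f i).
Proof.
move=> of_; rewrite /adjoin_limit_open /= preimage_bigcup; split.
  by apply: bigcup_open => i _; case: (of_ i).
move=> [i _ fin]; apply: filterS ((of_ i).2 fin).
exact: (@bigcup_sup _ _ i setT (fun i => Some @^-1` f i)).
Qed.

HB.instance Definition _ (Y : topologicalType) (F : filter_on Y) :=
  isOpenTopological.Build (adjoin_limit F) (@adjoin_limit_openT Y F)
    (@adjoin_limit_openI Y F) (@adjoin_limit_open_bigU Y F).

Lemma adjoin_limit_openE (Y : topologicalType) (F : filter_on Y)
    (W : set (adjoin_limit F)) :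
  open W <-> open (Some @^-1` W : set Y) /\
    (W None -> (F : set_system Y) (Some @^-1` W)).
Proof. by []. Qed.

Lemma preimage_Some_image (T : Type) (A : set T) : Some @^-1` (Some @` A) = A.
Proof.
by apply/seteqP; split=> [x [y Ay [<-]]//|x Ax]; exists x.
Qed.

Lemma open_Some_image (Y : topologicalType) (F : filter_on Y) (U : set Y) :
  open U -> open (Some @` U : set (adjoin_limit F)).
Proof.
move=> oU; apply/adjoin_limit_openE; rewrite preimage_Some_image.
by split=> // -[].
Qed.

Lemma embedding_Some (Y : topologicalType) (F : filter_on Y) :
  @embedding Y (adjoin_limit F) Some.
Proof.
split=> [x y []//|U]; split=> [oU|[V /adjoin_limit_openE[oV _] <-]//].
by exists (Some @` U); [exact: open_Some_image|exact: preimage_Some_image].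
Qed.

(** The new point is separated from [y] by a member of [F] whose closure misses
    [y]; openness of the base makes the interior of this member, together with
    the new point, a neighbourhood of the new point. *)
Lemma hausdorff_adjoin_limit (Y : topologicalType) (F : filter_on Y) :
  hausdorff_space Y ->
  (forall A, (F : set_system Y) A -> (F : set_system Y) A°) -> cluster F = set0 ->
  hausdorff_space (adjoin_limit F).
Proof.
move=> hY oF clF.
have sep_None (y : Y) : exists P Q : set (adjoin_limit F),
    [/\ open P, open Q, P (Some y), Q None & P `&` Q = set0].
  have : ~ cluster F y by rewrite clF.
  move=> /existsNP[A] /existsNP[N] /not_implyP[FA] /not_implyP[Ny AN0].
  exists (Some @` N°), (None |` Some @` A°); split.
  - exact: open_Some_image (open_interior _).
  - apply/adjoin_limit_openE.
    have -> : Some @^-1` (None |` Some @` A°) = A°.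
      rewrite preimage_setU preimage_Some_image.
      by apply/seteqP; split=> x; [case|right].
    by split=> [|_]; [exact: open_interior|exact: oF].
  - by exists y => //; exact: nbhs_interior.
  - by left.
  - rewrite -subset0 => _ [[x Nx <-]] [//|[z Az [zx]]]; apply: AN0.
    by exists x; split; apply: interior_subset => //; rewrite -zx.
rewrite open_hausdorff => -[x|] [y|] //= xy.
- have xy' : x != y by apply: contra_neq xy => ->.
  move: (hY); rewrite open_hausdorff => /(_ x y xy').
  move=> [[P Q] /= [/set_mem Px /set_mem Qy] [oP oQ /eqP PQ]].
  exists (Some @` P, Some @` Q) => /=.
    by split; apply/mem_set; [exists x|exists y].
  split; [exact: open_Some_image|exact: open_Some_image|].
  apply/eqP; rewrite -subset0 => _ [[z Pz <-] [t Qt [tz]]].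
  have PQ0 : P `&` Q = set0 := PQ.
  have : (P `&` Q) z by split=> //; rewrite -tz.
  by rewrite PQ0.
- have [P [Q [oP oQ Px Qn PQ]]] := sep_None x.
  by exists (P, Q) => /=; split=> //; [exact/mem_set|exact/mem_set|exact/eqP].
- have [P [Q [oP oQ Px Qn PQ]]] := sep_None y.
  exists (Q, P) => /=; split=> //; [exact/mem_set|exact/mem_set|].
  by rewrite setIC; apply/eqP.
Qed.

(** Otherwise the adjoined limit would be isolated, as the complement of the
    closed copy of [Y], so that [F] would contain the empty set. *)
Lemma h_closed_cluster (Y : topologicalType) (F : set_system Y) :
  ProperFilter F -> (forall A, F A -> F A°) -> h_closed Y ->
  cluster F !=set0.
Proof.
move=> FF oF [hY clY]; apply/set0P/negP => /eqP clF.
pose G := FilterType F FF.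
have /closed_openC := clY _ _ (@hausdorff_adjoin_limit Y G hY oF clF)
  (embedding_Some G).
move=> /adjoin_limit_openE[_ /(_ _)] F0.
apply: (@filter_not_empty _ F); apply: filterS (F0 _) => [x /=|[]//].
by apply; exists x.
Qed.

(** The traces of the [V n] generate an open filter on the H-closed subspace,
    proper because a point of [V n] lies in [A].  Its cluster points lie
    in the closure of each [V n] in [X], the inclusion being continuous. *)
Lemma nested_open_closures_meet (X : topologicalType) (A : set X)
    (V : nat -> set X) :
  h_closed (set_type (closure A)) ->
  (forall n, [/\ open (V n), V n !=set0 & V n `<=` A]) ->
  (forall m n, m <= n -> V n `<=` V m) ->
  exists2 x, closure A x & forall n, closure (V n) x.
Proof.
move=> hA oV decV.
pose tr n : set (set_type (closure A)) := set_val @^-1` V n.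
pose F := filter_from setT tr.
have otr n : open (tr n) by exists (V n) => //; case: (oV n).
have FF : ProperFilter F.
  apply: filter_from_proper => [|n _].
    apply: filter_from_filter; first by exists 0.
    move=> m n _ _; exists (maxn m n) => // x Vx.
    by split; apply: decV Vx; rewrite ?leq_maxl ?leq_maxr.
  have [_ [x Vx] VA] := oV n.
  have xA : x \in closure A by apply/mem_set/subset_closure/VA.
  by exists (SigSub xA); rewrite /tr /preimage /= .
have oF B : F B -> F B°.
  move=> [n _ VB]; exists n => // x Vx.
  by apply: filterS VB _; apply: open_nbhs_nbhs; split.
have [[x xA] clx] := h_closed_cluster FF oF hA.
exists x; first exact/set_mem.
move=> n N Nx.
have [] := clx (tr n) (set_val @^-1` N) (ex_intro2 _ _ n I (fun _ H => H)).
  exact: (@initial_continuous _ _ set_val (SigSub xA)).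
by move=> y [Vy Ny]; exists (set_val y).
Qed.

Lemma quasiregular_shrink (X : topologicalType) (U D : set X) :
  quasiregular X -> open U -> U !=set0 -> open D -> dense D ->
  exists W : set X, [/\ open W, W !=set0 & closure W `<=` U `&` D].
Proof.
by move=> qX oU U0 oD dD; apply: qX; [exact: openI|exact: dD].
Qed.

Theorem corollary4p6 (X : topologicalType) (hausX : hausdorff_space X)
  (qregX : quasiregular X)
  (hcpbX : exists B : set (set X), h_closed_pi_base B) :
  baire_space X.
Proof.
have [B [[oB piB] hB]] := hcpbX.
move=> F cF oF O O0 oO.
have [V0 [oV0 V00 clV0]] := qregX _ oO O0.
have [A BA AV0] := piB _ oV0 V00.
have [oA A0] := oB _ BA.
have clAO : closure A `<=` O by apply: subset_trans clV0; exact: closureS.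
(* The empty family has no enumeration; the constant sequence [setT] serves. *)
have [D DE] : exists D : nat -> set X,
    (forall n, open (D n) /\ dense (D n)) /\ forall U, F U -> exists n, D n = U.
  have [F0|/surjfunPex[D FE]] := pfcard_geP cF.
    exists (fun=> setT); split=> [n|U]; last by rewrite F0.
    by split=> [|P P0 _]; [exact: openT|rewrite setIT].
  exists D; split=> [n|U]; last first.
    by rewrite FE => -[n _ <-]; exists n.
  by apply: oF; rewrite FE; exists n.
case: DE => oD FD.
have /choice[f fP] : forall p : nat * set X, exists W : set X,
    open p.2 -> p.2 !=set0 ->
    [/\ open W, W !=set0 & closure W `<=` p.2 `&` D p.1].
  move=> [n U] /=.
  (* Choice needs a total function: [set0] is a dummy value off the open
     non-empty sets, which the recursion never leaves. *)
  have [oU|noU] := pselect (open U); last by exists set0.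
  have [U0|nU0] := pselect (U !=set0); last by exists set0.
  have [oDn dDn] := oD n.
  by have [W WP] := quasiregular_shrink qregX oU U0 oDn dDn; exists W.
pose V := nat_rect (fun=> set X) A (fun n U => f (n, U)).
have oV n : open (V n) /\ V n !=set0.
  by elim: n => [//|n [oVn Vn0]]; have [] := fP (n, V n) oVn Vn0.
have clV n : closure (V n.+1) `<=` V n `&` D n.
  by have [oVn Vn0] := oV n; have [] := fP (n, V n) oVn Vn0.
have decV m n : m <= n -> V n `<=` V m.
  elim: n => [|n IH]; first by rewrite leqn0 => /eqP ->.
  rewrite leq_eqVlt => /predU1P[->//|/IH VnVm] x /subset_closure /clV[Vn _].
  exact: VnVm.
have [|x Ax Vx] := nested_open_closures_meet (hB _ BA) _ decV.
  by move=> n; have [oVn Vn0] := oV n; split=> //; exact: (decV 0).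
exists x; split; first exact: clAO.
by move=> U /FD[n <-]; have [] := clV n x (Vx n.+1).
Qed.
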